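(* Let $n\geqslant 1$. Every $n$-valued group of order $3$, on a set $X=\{e,x_1,x_2\}$ with unit $e$, is given by a matrix of type $B_1$ or $B_2$. In the first case one has $$a_0c_0>0,$$ while in the second case $$b_0+a_0\bigl(b_0(n-b_0-b_1)+a_0b_1-a_1b_0\bigr)>0 .$$
   Context: $\mathrm{Sym}^n(X)=X^{n}/S_n$ is the set of $n$-element multisets of elements of $X$; a multiset is written as a formal sum $\sum_{x\in X} m_x\, x$ with non-negative integer multiplicities summing to $n$. An $n$-valued monoid is a set $X$ with an operation $\ast:X\times X\to \mathrm{Sym}^n(X)$ such that: (associativity) for all $x,y,z\in X$ the $n^2$-multisets $[x\ast w\mid w\in y\ast z]$ and $[w\ast z\mid w\in x\ast y]$ coincide (with $w$ running with multiplicity); (unit) there is $e\in X$ with $e\ast x=x\ast e=[x,\dots,x]$ ($n$ times) for every $x\in X$. Its order is $|X|$. An $n$-valued group is an $n$-valued monoid equipped with a map $\mathrm{inv}:X\to X$ such that $e\in x\ast \mathrm{inv}(x)$ and $e\in \mathrm{inv}(x)\ast x$ for every $x\in X$. An $n$-valued monoid structure on $X=\{e,x_1,x_2\}$ with unit $e$ is given by the $4\times3$ matrix $B$ whose rows list, in order, the multiplicities of $(e,x_1,x_2)$ in the products $x_1\ast x_1$, $x_1\ast x_2$, $x_2\ast x_1$, $x_2\ast x_2$. It is of type $B_1$ (respectively $B_2$), or belongs to the series $B_1$ (respectively $B_2$), if its matrix has the form $$B_1=\begin{pmatrix} a_0 & n-a_0 & 0\\ 0&0&n\\ 0&0&n\\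 c_0 & \frac{c_0n}{a_0} & n-c_0-\frac{c_0n}{a_0}\end{pmatrix}\quad (a_0\ne 0),$$ respectively $$B_2=\begin{pmatrix} a_0&a_1&n-a_0-a_1\\ b_0&b_1&n-b_0-b_1\\ b_0&b_1&n-b_0-b_1\\ \frac{b_0(n-b_0-b_1)+a_0b_1-a_1b_0}{n-a_0-a_1} & \frac{(b_0+b_1)(n-b_1)}{n-a_0-a_1} & \frac{(n-b_0-b_1)^2+n(b_1-a_0-a_1)+a_1b_0-a_0b_1}{n-a_0-a_1}\end{pmatrix}\quad (n-a_0-a_1\neq 0),$$ where $a_0,a_1,b_0,b_1,c_0$ are parameters and all entries are non-negative integers. *)

(* Defs.v *)
From mathcomp Require Import all_boot all_order all_algebra.
From mathcomp Require Export finmap multiset.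

Set Implicit Arguments.
Unset Strict Implicit.
Unset Printing Implicit Defensive.

Import GRing.Theory Num.Theory.

Local Open Scope mset_scope.

Record Sym (n : nat) (X : choiceType) := MkSym {
  sym_mset :> {mset X};
  sym_size : size sym_mset = n }.

(* For A : {mset X}, the sequence w <- A lists the elements of A with
   multiplicity, so both sides of nvmulA are multisets of n ^ 2 elements. *)
Record nvmonoid (n : nat) (X : choiceType) := NVMonoid {
  nvmul : X -> X -> Sym n X;
  nvunit : X;
  nvmulA : forall x y z : X,
    seq_mset [seq v | w <- nvmul y z, v <- nvmul x w] =
    seq_mset [seq v | w <- nvmul x y, v <- nvmul w z];
  nvmul1x : forall x : X, nvmul nvunit x = msetn n x :> {mset X};
  nvmulx1 : forall x : X, nvmul x nvunit = msetn n x :> {mset X} }.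

Record nvgroup (n : nat) (X : choiceType) := NVGroup {
  nvgroup_monoid :> nvmonoid n X;
  nvinv : X -> X;
  nvmulxV : forall x : X,
    nvunit nvgroup_monoid \in sym_mset (nvmul nvgroup_monoid x (nvinv x));
  nvmulVx : forall x : X,
    nvunit nvgroup_monoid \in sym_mset (nvmul nvgroup_monoid (nvinv x) x) }.

Local Open Scope ring_scope.

Definition rows43 (s : seq (seq rat)) : 'M[rat]_(4, 3) :=
  \matrix_(i < 4, j < 3) nth 0 (nth [::] s i) j.

(* The multiplicities are embedded in rat so that the subtractions and
   quotients in the families B1 and B2 are exact. *)
Definition nvmatrix (n : nat) (X : choiceType) (M : nvmonoid n X) (x1 x2 : X)
    : 'M[rat]_(4, 3) :=
  let mults x y :=
    [seq (sym_mset (nvmul M x y) z)%:R | z <- [:: nvunit M; x1; x2]] in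
  rows43 [:: mults x1 x1; mults x1 x2; mults x2 x1; mults x2 x2].

Definition B1 (n : nat) (a0 c0 : rat) : 'M[rat]_(4, 3) :=
  let N : rat := n%:R in
  rows43 [:: [:: a0; N - a0; 0];
             [:: 0; 0; N];
             [:: 0; 0; N];
             [:: c0; c0 * N / a0; N - c0 - c0 * N / a0]].

Definition B2 (n : nat) (a0 a1 b0 b1 : rat) : 'M[rat]_(4, 3) :=
  let N : rat := n%:R in
  let d := N - a0 - a1 in
  rows43 [:: [:: a0; a1; N - a0 - a1];
             [:: b0; b1; N - b0 - b1];
             [:: b0; b1; N - b0 - b1];
             [:: (b0 * (N - b0 - b1) + a0 * b1 - a1 * b0) / d;
                 (b0 + b1) * (N - b1) / d;
                 ((N - b0 - b1) ^+ 2 + N * (b1 - a0 - a1)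
                    + a1 * b0 - a0 * b1) / d]].

Definition is_B1 (n : nat) (B : 'M[rat]_(4, 3)) (a0 c0 : rat) : Prop :=
  [/\ a0 != 0, B = B1 n a0 c0 & forall i j, B i j \is a Num.nat].

Definition is_B2 (n : nat) (B : 'M[rat]_(4, 3)) (a0 a1 b0 b1 : rat) : Prop :=
  [/\ n%:R - a0 - a1 != 0, B = B2 n a0 a1 b0 b1
    & forall i j, B i j \is a Num.nat].

(* Main.v *)
Require Import Defs.
From mathcomp Require Import all_boot all_order all_algebra lra.

Import Order.TTheory GRing.Theory Num.Theory.

Local Open Scope ring_scope.

(** Extend the operation bilinearly to the free rational module on X.  The
    multiplicities become the structure constants of an associative algebra in
    which the unit acts as multiplication by n ([multA], [mult1x], [multx1]),
    and each product has total mass n ([mult_sum]).  Write a, b, b', c for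
    x1 * x1, x1 * x2, x2 * x1, x2 * x2, with coordinates a0, a1, a2 along
    e, x1, x2, and so on.

    The dichotomy is whether a2 vanishes.  If a2 <> 0, then x1 * x1 is, up to
    e and x1, a nonzero multiple of x2.  Since x1 commutes with its own square,
    it commutes with x2, so b = b'; and the relation
    x1 * (x1 * x2) = (x1 * x1) * x2 can be solved for the term a2 * c.  The
    solution is the last row of B2 ([order3_B2]).

    If a2 = 0, then e and x1 span a subalgebra.  Comparing coefficients in
    x1 * (x1 * x2) = (x1 * x1) * x2 and using that multiplicities are
    nonnegative gives b0 = 0, so the inverse of x1 can only be x1 and a0 <> 0.
    That forces b = n x2, and likewise b' = n x2 ([absorbed_product]).  Then
    x1 * (x2 * x2) = (x1 * x2) * x2 gives a0 * c1 = n * c0, which is B1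
    ([order3_B1]).

    For the inequalities: an inverse of x1 exists only if a0 or b0 is nonzero,
    and an inverse of x2 only if c0 or b'0 is ([order3_inv]).  In B1 both
    b0 and b'0 vanish, so a0 and c0 are positive.  In B2 the bracketed
    expression is c0 * a2 and b'0 = b0, so the quantity is b0 + a0 * a2 * c0
    with a2 > 0; it can vanish only if b0 = 0, and then a0, c0 > 0. *)

(** * Multiplicities as structure constants *)

Definition mult {n : nat} {X : choiceType} (M : nvmonoid n X) (x y z : X)
    : rat :=
  (sym_mset (nvmul M x y) z)%:R.

Lemma mult_ge0 {n : nat} {X : choiceType} (M : nvmonoid n X) (x y z : X) :
  0 <= mult M x y z.
Proof. exact: ler0n. Qed.

Lemma mult1x {n : nat} {X : choiceType} (M : nvmonoid n X) (x z : X) :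
  mult M (nvunit M) x z = if z == x then n%:R else 0.
Proof. by rewrite /mult nvmul1x msetnE; case: eqP. Qed.

Lemma multx1 {n : nat} {X : choiceType} (M : nvmonoid n X) (x z : X) :
  mult M x (nvunit M) z = if z == x then n%:R else 0.
Proof. by rewrite /mult nvmulx1 msetnE; case: eqP. Qed.

Lemma sum_over_mset (X : finType) (A : {mset X}%mset) (F : X -> nat) :
  (\sum_(w <- A) F w = \sum_w A w * F w)%N.
Proof.
rewrite sum_mset [RHS](bigID [in finsupp A]) /=.
rewrite [X in (_ = _ + X)%N]big1 => [|w]; last first.
  by rewrite memNfinsupp => /eqP ->.
rewrite addn0 -[RHS]big_enum; apply: perm_big.
apply: uniq_perm => [||w]; rewrite ?fset_uniq ?enum_uniq //.
by rewrite mem_enum.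
Qed.

Lemma mult_sum {n : nat} {X : finType} (M : nvmonoid n X) (x y : X) :
  \sum_z mult M x y z = n%:R.
Proof.
rewrite -natr_sum -[in RHS](sym_size (nvmul M x y)) -sum1_size sum_over_mset.
by under [in RHS]eq_bigr do rewrite muln1.
Qed.

Lemma count_product_list {n : nat} {X : finType} (A : {mset X}%mset)
    (f : X -> Sym n X) (v : X) :
  (count_mem v [seq u | w <- A, u <- f w] = \sum_w A w * sym_mset (f w) v)%N.
Proof.
rewrite count_flatten -map_comp sumnE big_map sum_over_mset.
by apply: eq_bigr => w _; rewrite /= map_id count_mem_mset.
Qed.

Lemma multA {n : nat} {X : finType} (M : nvmonoid n X) (x y z v : X) :
  \sum_w mult M y z w * mult M x w v = \sum_w mult M x y w * mult M w z v.
Proof.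
have /msetP/(_ v) := nvmulA M x y z.
rewrite !mset_seqE !count_product_list => /(congr1 (fun k => k%:R : rat)).
by rewrite !natr_sum; under eq_bigr do rewrite natrM;
   under [in RHS]eq_bigr do rewrite natrM.
Qed.

(** * Coordinates in order three *)

Lemma triple_uniq (T : finType) (a b c : T) :
  #|T| = 3%N -> [set: T] = [set a; b; c] -> uniq [:: a; b; c].
Proof.
move=> cardT T_eq; apply: (@leq_size_uniq _ (enum T)); first exact: enum_uniq.
  by move=> z _; have := in_setT z; rewrite T_eq !inE -orbA.
by rewrite -cardE cardT.
Qed.

Lemma triple_sum (T : finType) (a b c : T) (F : T -> rat) :
  #|T| = 3%N -> [set: T] = [set a; b; c] ->
  \sum_z F z = F a + F b + F c.
Proof.
move=> cardT T_eq; have := triple_uniq _ _ _ _ cardT T_eq.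
rewrite /= !inE negb_or andbT => /andP[/andP[ab ac] bc].
rewrite (eq_bigl [in [set a; b; c]]) => [|z]; last by rewrite -T_eq in_setT.
rewrite -setUA big_setU1 ?big_setU1 ?big_set1 /= ?addrA //.
  by rewrite inE.
by rewrite !inE negb_or ab.
Qed.

(** An inverse of a non-unit x is not the unit, since x * e = n x, so it is x
    itself or the remaining element y. *)
Lemma order3_inv {n : nat} {X : finType} (G : nvgroup n X) (x y : X) :
  x != nvunit G -> [set: X] = [set nvunit G; x; y] ->
  mult G x x (nvunit G) != 0 \/ mult G x y (nvunit G) != 0.
Proof.
move=> x_neq_e X_eq; have := in_setT (nvinv G x); have := nvmulxV G x.
rewrite X_eq !inE -mset_neq0 /mult -orbA => xV /or3P[] /eqP xVE.
- by move: xV; rewrite xVE nvmulx1 msetnE (eq_sym _ x) (negPf x_neq_e).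
- by left; rewrite pnatr_eq0 -{2}xVE.
- by right; rewrite pnatr_eq0 -xVE.
Qed.

Lemma rows43_inj (s t : seq (seq rat)) :
  rows43 s = rows43 t ->
  map size s = nseq 4 3%N -> map size t = nseq 4 3%N -> s = t.
Proof.
have row_size u i : map size u = nseq 4 3%N -> (i < 4)%N ->
    size (nth [::] u i) = 3%N.
  move=> uE i_lt4; have size_u : size u = 4 by rewrite -(size_map size) uE.
  by rewrite -(nth_map _ 0%N) ?size_u // uE nth_nseq i_lt4.
move=> /matrixP st sE tE.
have size_s : size s = 4 by rewrite -(size_map size) sE.
have size_t : size t = 4 by rewrite -(size_map size) tE.
apply: (@eq_from_nth _ [::]) => [|i]; rewrite size_s ?size_t // => i_lt4.
apply: (@eq_from_nth _ 0) => [|j]; rewrite !row_size // => j_lt3.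
by have := st (Ordinal i_lt4) (Ordinal j_lt3); rewrite !mxE.
Qed.

Lemma nvmatrixE {n : nat} {X : choiceType} (M : nvmonoid n X) (x1 x2 : X) :
  let row x y := [:: mult M x y (nvunit M); mult M x y x1; mult M x y x2] in
  nvmatrix M x1 x2 = rows43 [:: row x1 x1; row x1 x2; row x2 x1; row x2 x2].
Proof. by []. Qed.

Lemma nvmatrix_nat {n : nat} {X : choiceType} (M : nvmonoid n X) (x1 x2 : X) :
  forall i j, nvmatrix M x1 x2 i j \is a Num.nat.
Proof.
move=> i j; rewrite mxE.
case: i => [[|[|[|[|i]]]] //= _]; case: j => [[|[|[|j]]] //= _];
  exact: natr_nat.
Qed.

(** * The two series *)

(** Here (b0, b1, b2) are the coordinates of x1 * x2 or of x2 * x1, when x1 * x1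
    is a0 e + (N - a0) x1.  The last two hypotheses are the e- and
    x1-coefficients of x1 * (x1 * x2) = (x1 * x1) * x2, or of its mirror image
    x2 * (x1 * x1) = (x2 * x1) * x1.  In the x1-coefficient the terms
    b1 * (N - a0) have cancelled, which leaves two nonnegative terms, so both
    vanish; then the e-coefficient reads b1 * a0 = 0. *)
Lemma absorbed_product (N a0 b0 b1 b2 : rat) :
  0 < N -> 0 <= b0 -> 0 <= b1 -> 0 <= b2 -> b0 + b1 + b2 = N ->
  b1 * a0 + b2 * b0 = (N - a0) * b0 -> b0 * N + b2 * b1 = 0 ->
  b0 = 0 /\ (a0 != 0 -> b1 = 0 /\ b2 = N).
Proof.
move=> N_gt0 b0_ge0 b1_ge0 b2_ge0 b_sum coef_e coef_x1.
have b0_eq0 : b0 = 0.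
  have b0N_ge0 := mulr_ge0 b0_ge0 (ltW N_gt0).
  have b21_ge0 := mulr_ge0 b2_ge0 b1_ge0.
  have /eqP : b0 * N = 0 by lra.
  by rewrite mulf_eq0 (gt_eqF N_gt0) orbF => /eqP.
split=> // a0_neq0; move: coef_e; rewrite b0_eq0 !mulr0 addr0 => /eqP.
rewrite mulf_eq0 (negPf a0_neq0) orbF => /eqP b1_eq0; split=> //.
by move: b_sum; rewrite b0_eq0 b1_eq0 !add0r.
Qed.

(** As x1 commutes with x1 * x1, which involves x2, it commutes with x2; and
    x1 * (x1 * x2) = (x1 * x1) * x2, divided by the multiplicity of x2 in
    x1 * x1, expresses x2 * x2 through the two other products. *)
Lemma order3_B2 {n : nat} {X : finType} (M : nvmonoid n X) (x1 x2 : X) :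
  #|X| = 3%N -> [set: X] = [set nvunit M; x1; x2] ->
  mult M x1 x1 x2 != 0 ->
  nvmatrix M x1 x2 =
    B2 n (mult M x1 x1 (nvunit M)) (mult M x1 x1 x1)
         (mult M x1 x2 (nvunit M)) (mult M x1 x2 x1).
Proof.
move=> cardX X_eq a2_neq0; set e := nvunit M in X_eq *.
have sum3 F := triple_sum X e x1 x2 F cardX X_eq.
have := triple_uniq X e x1 x2 cardX X_eq.
rewrite /= !inE negb_or andbT => /andP[/andP[/negPf ex1 /negPf ex2] /negPf x12].
have units := (mult1x M, multx1 M, eqxx, ex1, ex2, x12,
               eq_sym x1 e, eq_sym x2 e, eq_sym x2 x1).
have a_sum := mult_sum M x1 x1; have b_sum := mult_sum M x1 x2.
rewrite !sum3 in a_sum b_sum.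
have x1_x2_comm v : mult M x2 x1 v = mult M x1 x2 v.
  (* In (x1 * x1) * x1 = x1 * (x1 * x1) all terms but a2 b' and a2 b cancel. *)
  have := multA M x1 x1 x1 v; rewrite !sum3 !mult1x !multx1 => powers.
  by apply: (mulfI a2_neq0); lra.
have square_x2 v := multA M x1 x1 x2 v.
have := square_x2 e; have := square_x2 x1; have {square_x2} := square_x2 x2.
rewrite !sum3 !units => sq_x2 sq_x1 sq_e.
have a2E : mult M x1 x1 x2 = n%:R - mult M x1 x1 e - mult M x1 x1 x1 by lra.
have b2E : mult M x1 x2 x2 = n%:R - mult M x1 x2 e - mult M x1 x2 x1 by lra.
rewrite /B2 nvmatrixE -/e !x1_x2_comm -a2E -b2E.
congr (rows43 [:: _; _; _; [:: _; _; _]]); apply: (mulIf a2_neq0);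
  rewrite divfK //.
- lra.
- rewrite b2E in sq_x1 *; lra.
- rewrite a2E in sq_x2 *; rewrite b2E in sq_x2 *; lra.
Qed.

(** When x2 does not occur in x1 * x1, the span of e and x1 is a subalgebra,
    and [absorbed_product] applies to x1 * x2 and to x2 * x1.  The inverse of x1 is
    needed to exclude x1 * x1 = n x1, the one case in which that lemma leaves
    coordinates undetermined. *)
Lemma order3_B1 {n : nat} {X : finType} (G : nvgroup n X) (x1 x2 : X) :
  (0 < n)%N -> #|X| = 3%N -> [set: X] = [set nvunit G; x1; x2] ->
  mult G x1 x1 x2 = 0 ->
  mult G x1 x1 (nvunit G) != 0 /\
  nvmatrix G x1 x2 =
    B1 n (mult G x1 x1 (nvunit G)) (mult G x2 x2 (nvunit G)).
Proof.
move=> n_gt0 cardX X_eq a2_eq0; set e := nvunit G in X_eq *.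
have sum3 F := triple_sum X e x1 x2 F cardX X_eq.
have := triple_uniq X e x1 x2 cardX X_eq.
rewrite /= !inE negb_or andbT => /andP[/andP[/negPf ex1 /negPf ex2] /negPf x12].
have units := (mult1x G, multx1 G, eqxx, ex1, ex2, x12,
               eq_sym x1 e, eq_sym x2 e, eq_sym x2 x1).
have N_gt0 : 0 < n%:R :> rat by rewrite ltr0n.
have a_sum := mult_sum G x1 x1; have c_sum := mult_sum G x2 x2.
rewrite !sum3 a2_eq0 in a_sum c_sum.
have a1E : mult G x1 x1 x1 = n%:R - mult G x1 x1 e by lra.
have [b0_eq0 b_absorbed] : mult G x1 x2 e = 0 /\
    (mult G x1 x1 e != 0 -> mult G x1 x2 x1 = 0 /\ mult G x1 x2 x2 = n%:R).
  have := multA G x1 x1 x2 x1; have := multA G x1 x1 x2 e.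
  rewrite !sum3 !units a2_eq0 a1E => assoc_e assoc_x1.
  apply: absorbed_product N_gt0 _ _ _ _ _ _; rewrite ?mult_ge0 //.
  - by rewrite -(mult_sum G x1 x2) sum3.
  - by lra.
  - by lra.
have [b0'_eq0 b'_absorbed] : mult G x2 x1 e = 0 /\
    (mult G x1 x1 e != 0 -> mult G x2 x1 x1 = 0 /\ mult G x2 x1 x2 = n%:R).
  have := multA G x2 x1 x1 x1; have := multA G x2 x1 x1 e.
  rewrite !sum3 !units a2_eq0 a1E => assoc_e assoc_x1.
  apply: absorbed_product N_gt0 _ _ _ _ _ _; rewrite ?mult_ge0 //.
  - by rewrite -(mult_sum G x2 x1) sum3.
  - by lra.
  - by lra.
have a0_neq0 : mult G x1 x1 e != 0.
  have := order3_inv G x1 x2; rewrite b0_eq0 eqxx -/e eq_sym ex1.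
  by case/(_ isT X_eq).
split=> //.
have [b1_eq0 b2E] := b_absorbed a0_neq0.
have [b1'_eq0 b2'E] := b'_absorbed a0_neq0.
have := multA G x1 x2 x2 e; rewrite !sum3 !units b0_eq0 b1_eq0 b2E => c1_e.
have c1E : mult G x2 x2 x1 = mult G x2 x2 e * n%:R / mult G x1 x1 e.
  by apply: (mulIf a0_neq0); rewrite divfK //; lra.
rewrite /B1 -c1E nvmatrixE -/e.
rewrite a1E a2_eq0 b0_eq0 b1_eq0 b2E b0'_eq0 b1'_eq0 b2'E.
by congr (rows43 [:: _; _; _; [:: _; _; _]]); lra.
Qed.

Theorem corollary2 (n : nat) (n_ge1 : (1 <= n)%N) (X : finType)
    (G : nvgroup n X) (x1 x2 : X)
    (cardX : #|X| = 3%N) (X_eq : [set: X] = [set nvunit G; x1; x2]) :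
  let B := nvmatrix G x1 x2 in
  [/\ (exists a0 c0 : rat, is_B1 n B a0 c0) \/
      (exists a0 a1 b0 b1 : rat, is_B2 n B a0 a1 b0 b1),
      forall a0 c0 : rat, is_B1 n B a0 c0 -> 0 < a0 * c0
    & forall a0 a1 b0 b1 : rat, is_B2 n B a0 a1 b0 b1 ->
        0 < b0 + a0 * (b0 * (n%:R - b0 - b1) + a0 * b1 - a1 * b0)].
Proof.
move=> B; set e := nvunit G in X_eq.
have := triple_uniq X e x1 x2 cardX X_eq.
rewrite /= !inE negb_or andbT => /andP[/andP[ex1 ex2] x12].
have inv_x1 : mult G x1 x1 e != 0 \/ mult G x1 x2 e != 0.
  by apply: order3_inv X_eq; rewrite eq_sym.
have inv_x2 : mult G x2 x2 e != 0 \/ mult G x2 x1 e != 0.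
  by apply: order3_inv; rewrite 1?eq_sym // X_eq setUAC.
have ge0 := mult_ge0 G; split.
- have B_nat := nvmatrix_nat G x1 x2.
  case: (eqVneq (mult G x1 x1 x2) 0) => [a2_eq0 | a2_neq0].
    left; have [a0_neq0 BE] := order3_B1 G x1 x2 n_ge1 cardX X_eq a2_eq0.
    by do 2!eexists; split; [exact: a0_neq0 | exact: BE |].
  right; do 4!eexists; split; [|exact: order3_B2 | exact: B_nat].
  have := mult_sum G x1 x1; rewrite (triple_sum X e x1 x2) // => <-.
  by rewrite -/e; apply: contra a2_neq0 => /eqP a2_eq0; apply/eqP; lra.
- move=> a0 c0 [a0_neq0 + _]; rewrite /B nvmatrixE -/e => BE.
  have [a0E _ _ b0E _ _ b0'E _ _ c0E _ _] := rows43_inj _ _ BE erefl erefl.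
  rewrite b0E b0'E eqxx a0E c0E in inv_x1 inv_x2.
  case: inv_x2 => // c0_neq0; rewrite mulr_gt0 // lt0r ?a0_neq0 ?c0_neq0.
    by rewrite -a0E ge0.
  by rewrite -c0E ge0.
move=> a0 a1 b0 b1 [a2_neq0 + _]; rewrite /B nvmatrixE -/e => BE.
have [a0E _ a2E b0E _ _ b0'E _ _ c0E _ _] := rows43_inj _ _ BE erefl erefl.
(* The bracket is the numerator of the entry c0 of B2, whose denominator is the
   multiplicity of x2 in x1 * x1. *)
have -> : b0 * (n%:R - b0 - b1) + a0 * b1 - a1 * b0 =
    mult G x2 x2 e * mult G x1 x1 x2 by rewrite c0E a2E divfK.
rewrite -a2E in a2_neq0; rewrite b0'E -b0E in inv_x2; rewrite -b0E -a0E.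
have bracket_ge0 : 0 <= mult G x1 x1 e * (mult G x2 x2 e * mult G x1 x1 x2).
  by rewrite !mulr_ge0.
case: (eqVneq (mult G x1 x2 e) 0) => [b0_eq0 | b0_neq0]; last first.
  by rewrite ltr_wpDr // lt0r b0_neq0 ge0.
rewrite b0_eq0 eqxx in inv_x1 inv_x2.
case: inv_x1 => // a0_neq0; case: inv_x2 => // c0_neq0.
by rewrite b0_eq0 add0r lt0r bracket_ge0 !mulf_neq0.
Qed.
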